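(* Let $a<b$, let $f:[a,b]\to\mathbb{R}$ be continuous and let $c>0$. Put $$\tau_U:=\inf\{s\in[a,b]: f(s)-\inf_{a\le u\le s}f(u)\ge c\},\qquad \tau_D:=\inf\{s\in[a,b]:\sup_{a\le u\le s}f(u)-f(s)\ge c\}$$ (with $\inf\emptyset=+\infty$), assume that $\min(\tau_U,\tau_D)<+\infty$, and put $$x:=\begin{cases} f(\tau_U)-c/2, & \text{if }\tau_U<\tau_D,\\ f(\tau_D)+c/2, & \text{if }\tau_U>\tau_D.\end{cases}$$ Let $(f_1,f_2)$ be the solution of the two-sided Skorokhod problem for $f$ with starting point $x$ and tube half-width $c/2$ (as defined in the context), and let $g^c$ be the function defined in the context. Then for every $t\in[a,b]$ $$g^c(t)=x+f_1(t)-f_2(t),$$ and consequently $$\mathrm{TV}^c(f,[a,t])=f_1(t)+f_2(t).$$ Moreover, $f_1(s)=f_2(s)=0$ for all $s\in[a,b]$ with $s\le\min(\tau_U,\tau_D)$.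
   Context: Truncated variations. For $c\ge 0$ and $f:[a,b]\to\mathbb{R}$, the truncated variation of $f$ on $[a,t]$, $t\in[a,b]$, is $$\mathrm{TV}^c(f,[a,t]):=\sup_{n}\ \sup_{a\le t_1<t_2<\dots<t_n\le t}\ \sum_{i=1}^{n-1}\phi_c\big(f(t_{i+1})-f(t_i)\big),\qquad \phi_c(y)=\max\{|y|-c,0\}.$$ The upward truncated variation $\mathrm{UTV}^c(f,[a,t])$ and the downward truncated variation $\mathrm{DTV}^c(f,[a,t])$ are defined by the same formula with $\phi_c(y)=\max\{y-c,0\}$ and $\phi_c(y)=\max\{-y-c,0\}$, respectively. ($\mathrm{TV}^0$ is the usual total variation; an empty sum is $0$.) The function $g^c$. With $x$ as in the claim, $$g^c(s):=x+\mathrm{UTV}^c(f,[a,s])-\mathrm{DTV}^c(f,[a,s]),\qquad s\in[a,b].$$ (It is known that $\mathrm{TV}^c(f,[a,b])=\inf\{\mathrm{TV}^0(g,[a,b]):\ \sup_{s\in[a,b]}|g(s)-f(s)|\le c/2\}$ and that $g^c$ attains this infimum.) Two-sided Skorokhod problem. For continuous $f:[a,b]\to\mathbb{R}$, $c>0$ and $x\in[f(a)-c/2,f(a)+c/2]$, it is known that there is a unique pair of continuous functions $f_1,f_2:[a,b]\to\mathbb{R}$ (called the solution) such that: (1) $f_1(a)=f_2(a)=0$; (2) $h(s):=f(s)-(x+f_1(s)-f_2(s))\in[-c/2,c/2]$ for all $s\in[a,b]$; (3) $f_1$ is non-decreasing and the associated Stieltjes measure $\mathrm{d}f_1$ is carried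 by $\{t:h(t)=c/2\}$; (4) $f_2$ is non-decreasing and the associated Stieltjes measure $\mathrm{d}f_2$ is carried by $\{t:h(t)=-c/2\}$. The $x$ of the claim is well defined (when finite minimum, $\tau_U\neq\tau_D$) and lies in $[f(a)-c/2,f(a)+c/2]$. *)

(* Defs.v *)
From HB Require Import structures.
From mathcomp Require Import all_boot all_order all_algebra.
From mathcomp Require Import all_classical all_reals all_analysis.

Set Implicit Arguments.
Unset Strict Implicit.
Unset Printing Implicit Defensive.

Import Order.TTheory GRing.Theory Num.Theory.
Import numFieldNormedType.Exports.

Local Open Scope classical_set_scope.
Local Open Scope ring_scope.

(* A function on [a, b] is represented by a function on R of which only the
   values on [a, b] are ever used. *)

(* The strictly increasing finite sequence of times t_1 < ... < t_n is a sorted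
   list s, with t_{i+1} = s`_i.  The supremum is taken in \bar R, so it is +oo
   rather than a junk value when it is not finite. *)
Definition phi_variation (R : realType) (phi : R -> R) (f : R -> R) (a t : R) :
    \bar R :=
  ereal_sup [set (\sum_(0 <= i < (size s).-1) phi (f s`_i.+1 - f s`_i))%:E |
             s in [set s : seq R | sorted <%R s /\
                                   {in s, forall u, a <= u <= t}]].

Definition TV (R : realType) (c : R) : (R -> R) -> R -> R -> \bar R :=
  phi_variation (fun y => Num.max (`|y| - c) 0).

Definition UTV (R : realType) (c : R) : (R -> R) -> R -> R -> \bar R :=
  phi_variation (fun y => Num.max (y - c) 0).

Definition DTV (R : realType) (c : R) : (R -> R) -> R -> R -> \bar R :=
  phi_variation (fun y => Num.max (- y - c) 0).

Definition gc (R : realType) (f : R -> R) (a c x : R) (s : R) : \bar R :=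
  (x%:E + UTV c f a s - DTV c f a s)%E.

Definition tauU (R : realType) (f : R -> R) (a b c : R) : \bar R :=
  ereal_inf [set s%:E | s in [set s | a <= s <= b /\
    c <= f s - inf [set f u | u in `[a, s]]]].

Definition tauD (R : realType) (f : R -> R) (a b c : R) : \bar R :=
  ereal_inf [set s%:E | s in [set s | a <= s <= b /\
    c <= sup [set f u | u in `[a, s]] - f s]].

(* For f continuous on [a, b] and 0 < c, the two times differ as soon as one of
   them is finite, so that the else branch is the case tauD < tauU. *)
Definition start_point (R : realType) (f : R -> R) (a b c : R) : R :=
  if (tauU f a b c < tauD f a b c)%E
  then f (fine (tauU f a b c)) - c / 2
  else f (fine (tauD f a b c)) + c / 2.

Definition clamp (R : realType) (a b s : R) : R := Num.max a (Num.min s b).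

(* The Stieltjes measure of g : [a, b] -> R is that of its extension to R by
   the constants g a and g b.  The extension G is determined by g; asking for it
   as an element of [cumulative R R] bundles the monotonicity and the
   right-continuity that the measure requires, which hold for every continuous
   nondecreasing g, by stieltjes_extension below. *)
Definition stieltjes_carried_by (R : realType) (a b : R) (g : R -> R)
    (S : set R) : Prop :=
  exists2 G : cumulative R R, (forall s, G s = g (clamp a b s)) &
    lebesgue_stieltjes_measure G (`[a, b] `\` S) = 0%E.

Record skorokhod_solution (R : realType) (f : R -> R) (a b c x : R)
    (f1 f2 : R -> R) : Prop := SkorokhodSolution {
  sk_continuous1 : {within `[a, b], continuous f1} ;
  sk_continuous2 : {within `[a, b], continuous f2} ;
  sk_init1 : f1 a = 0 ;
  sk_init2 : f2 a = 0 ;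
  sk_tube : forall s, a <= s <= b ->
    - (c / 2) <= f s - (x + f1 s - f2 s) <= c / 2 ;
  sk_nondecreasing1 : forall s t, a <= s -> s <= t -> t <= b -> f1 s <= f1 t ;
  sk_carried1 : stieltjes_carried_by a b f1
    [set s | a <= s <= b /\ f s - (x + f1 s - f2 s) = c / 2] ;
  sk_nondecreasing2 : forall s t, a <= s -> s <= t -> t <= b -> f2 s <= f2 t ;
  sk_carried2 : stieltjes_carried_by a b f2
    [set s | a <= s <= b /\ f s - (x + f1 s - f2 s) = - (c / 2)] }.

Lemma clamp_in (R : realType) (a b s : R) : a <= b ->
  clamp a b s \in `[a, b].
Proof.
by move=> ab; rewrite in_itv/= le_max lexx/= ge_max ab/= ge_min lexx orbT.
Qed.

Lemma stieltjes_extension (R : realType) (a b : R) (g : R -> R) : a <= b ->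
  {within `[a, b], continuous g} ->
  (forall s t, a <= s -> s <= t -> t <= b -> g s <= g t) ->
  exists G : cumulative R R, forall s, G s = g (clamp a b s).
Proof.
move=> ab gc gnd.
have nd : nondecreasing (g \o clamp a b).
  move=> s t st /=; have /[!in_itv]/= /andP[? _] := clamp_in s ab.
  have /[!in_itv]/= /andP[_ ?] := clamp_in t ab.
  by apply: gnd => //; rewrite /clamp le_max2// le_min2.
have clamp_ct : continuous (clamp a b).
  move=> s; apply: (@continuous_max _ _ (cst a) (Num.min^~ b)).
    exact: cvg_cst.
  by apply: (@continuous_min _ _ id (cst b)); [exact: cvg_id|exact: cvg_cst].
have ct : continuous (g \o clamp a b).
  move=> s; have /subspace_continuousP/(_ _ (clamp_in s ab)) gs := gc.
  apply: (@cvg_comp _ _ _ (clamp a b) g) gs => A /(clamp_ct s) As.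
  have {}As : \forall u \near s, `[a, b]%classic (clamp a b u) -> A (clamp a b u).
    exact: As.
  by apply: filterS As => u; apply; exact: clamp_in.
pose mG := isCumulative.Build R _ R (g \o clamp a b) nd (right_continuousW ct).
by exists (HB.pack_for (cumulative R R) (g \o clamp a b) mG).
Qed.

(* Main.v *)
Require Import Defs.
From mathcomp Require Import all_boot all_order all_algebra.
From mathcomp Require Import all_classical all_reals all_analysis.
From mathcomp Require Import lra.

Set Implicit Arguments.
Unset Strict Implicit.
Unset Printing Implicit Defensive.

Import Order.TTheory GRing.Theory Num.Theory.
Import numFieldNormedType.Exports.

Local Open Scope classical_set_scope.
Local Open Scope ring_scope.

(** Write g = x + f1 - f2 and h = f - g, so that |h| <= c / 2.

    Upper bounds.  For u <= v the tube condition gives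
    f v - f u - c <= g v - g u <= f1 v - f1 u, and symmetrically
    f u - f v - c <= f2 v - f2 u.  Summing over a subdivision of [a, t] bounds
    the upward, downward and full truncated sums by f1 t, f2 t and f1 t + f2 t
    (phi_sum_le, truncated_variations).

    Attainment.  It is enough to find, for each t, one subdivision of [a, t]
    whose full truncated sum is f1 t + f2 t: the full sum is the upward one plus
    the downward one, so the same subdivision then attains f1 t and f2 t.  The
    function f1 is flat where h <> c / 2 and f2 is flat where h <> - c / 2.  If
    p < q, h p = - c / 2, h q = c / 2 and f2 is flat on [p, q], then
    f q - f p - c = f1 q - f1 p exactly, and symmetrically
    (phi_sum_contact).  A subdivision that alternates between contacts with the
    two sides of the tube therefore has the required sum.  By continuity of h,
    one of f1 and f2 is flat near every point (regulator_locally_flat), so that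
    the alternating subdivision can be extended step by step along [a, b]; the
    finitely many alternations need not be counted, as a local-to-global
    induction on the interval does the work (interval_induction, phase_all).

    Start.  With T = min (tauU, tauD) and x as in the theorem, f - x stays in
    [- c / 2, c / 2] on [a, T], touches one side at T and the other at some
    p <= T (first_exit).  On such an interval both regulators vanish
    (regulator_eq0), which is the last claim and the initial phase of the
    alternation.  The case tauD <= tauU follows from the other one by changing
    the sign of f. *)

(** * Induction along a segment, contacts and flat pieces *)

Lemma within_itv_continuousP (R : realType) (a b x e : R) (h : R -> R) :
  {within `[a, b], continuous h} -> a <= x <= b -> 0 < e ->
  exists2 d, 0 < d &
    forall u, a <= u <= b -> `|u - x| < d -> `|h u - h x| < e.
Proof.
move=> /subspace_continuousP hc xab e0.
have xin : `[a, b]%classic x by rewrite /= in_itv.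
have /cvgrPdist_lt/(_ e e0) := hc x xin.
move=> /nbhs_ballP[d /= d0 dP]; exists d => // u uab ux.
rewrite distrC; apply: dP; first by rewrite /ball/= distrC.
by rewrite in_itv.
Qed.

(** A property that holds at a and is propagated to the right inside a
    neighbourhood of each point of [a, b] holds on [a, b]: consider the supremum
    of the points where it holds. *)
Lemma interval_induction (R : realType) (a b : R) (P : R -> Prop) :
  P a ->
  (forall x, a <= x <= b -> exists2 d, 0 < d & forall u v,
    a <= u -> x - d < u -> u <= v -> v < x + d -> v <= b -> P u -> P v) ->
  forall t, a <= t <= b -> P t.
Proof.
move=> Pa loc t /andP[at_ tb].
pose A : set R := [set s | a <= s <= t /\ P s].
have A0 : A !=set0 by exists a; split => //; rewrite lexx.
have hsA : has_sup A by split=> //; exists t => s [/andP[]].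
have asup : a <= sup A by apply: sup_upper_bound => //; split => //; rewrite lexx.
have supt : sup A <= t by apply: sup_le_ub => // s [/andP[]].
have [|d d0 dP] := loc (sup A); first by rewrite asup (le_trans supt).
have [s [/andP[as_ st] Ps] ds] := sup_adherent d0 hsA.
have ssup : s <= sup A.
  by apply: sup_upper_bound => //; split => //; rewrite as_.
have [ltt|] := ltP t (sup A + d); first exact: (dP s t).
move=> dt; exfalso.
have : A (sup A + d / 2).
  split; first by apply/andP; split; lra.
  by apply: (dP s) => //; lra.
by move=> /(sup_upper_bound hsA); lra.
Qed.

(** The measure of ]u, v] is g v - g u; monotonicity of the underlying outer
    measure makes the measurability of S irrelevant. *)
Lemma carried_flat (R : realType) (a b u v : R) (g : R -> R) (S : set R) :
  a <= u -> u <= v -> v <= b -> stieltjes_carried_by a b g S ->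
  (forall q, u < q <= v -> ~ S q) -> g u = g v.
Proof.
move=> au uv vb [G GE G0] nS.
have Guv : lebesgue_stieltjes_measure G `]u, v]%classic = (G v - G u)%:E.
  rewrite /lebesgue_stieltjes_measure /measure_extension/= measurable_mu_extE/=.
    by rewrite wlength_itv_bnd.
  exact: is_ocitv.
have : (lebesgue_stieltjes_measure G `]u, v]%classic <= 0)%E.
  rewrite -G0; apply: le_mu_ext => q /=; rewrite !in_itv/= => /andP[uq qv].
  split; first by apply/andP; split; lra.
  by apply: nS; rewrite uq.
rewrite Guv lee_fin.
have := cumulative_is_nondecreasing G _ _ uv.
rewrite !GE /clamp.
rewrite (min_l (le_trans uv vb)) (max_r au) (min_l vb) (max_r (le_trans au uv)).
by lra.
Qed.

(** The last time before v at which the level l is reached. *)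
Lemma last_level (R : realType) (a b u v q0 l : R) (h : R -> R) :
  {within `[a, b], continuous h} -> a <= u -> v <= b ->
  u <= q0 <= v -> h q0 = l ->
  exists2 q, u <= q <= v /\ h q = l & forall r, q < r <= v -> h r <> l.
Proof.
move=> hc au vb uqv hq0.
pose A : set R := [set s | u <= s <= v /\ h s = l].
have A0 : A !=set0 by exists q0; split.
have hsA : has_sup A by split=> //; exists v => s [/andP[]].
have us : u <= sup A.
  by apply: (@le_trans _ _ q0); [lra|apply: sup_upper_bound].
have sv : sup A <= v by apply: sup_le_ub => // s [/andP[]].
exists (sup A); last first.
  move=> r /andP[Ar rv] hr.
  have : r <= sup A by apply: sup_upper_bound => //; split => //; lra.
  by lra.
split; first by rewrite us.
apply/eqP/negPn/negP => /eqP neq.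
have e0 : 0 < `|h (sup A) - l| by rewrite normr_gt0 subr_eq0; apply/eqP.
have [|d d0 dP] := within_itv_continuousP (x := sup A) hc _ e0; first by lra.
have [s [suv hs] ds] := sup_adherent d0 hsA.
have ssup : s <= sup A by apply: sup_upper_bound.
have : `|h s - h (sup A)| < `|h (sup A) - l|.
  apply: dP; first by lra.
  by rewrite distrC ger0_norm; lra.
by rewrite hs distrC ltxx.
Qed.

(** A function whose Stieltjes measure is carried by a level set of h has the
    same value at v as at the last visit of h to that level, if it has increased
    on [u, v] at all. *)
Lemma last_increase (R : realType) (a b u v l : R) (h F : R -> R) :
  {within `[a, b], continuous h} ->
  stieltjes_carried_by a b F [set s | a <= s <= b /\ h s = l] ->
  a <= u -> u <= v -> v <= b -> F u <> F v ->
  exists q, [/\ u <= q <= v, h q = l & F q = F v].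
Proof.
move=> hc Fc au uv vb Fuv.
have [[q0 [quv hq0]]|noq] := pselect (exists q, u <= q <= v /\ h q = l).
  have [q [quv' hq] qP] := last_level hc au vb quv hq0.
  exists q; split => //; apply: (carried_flat _ _ _ Fc); [lra|lra|lra|].
  by move=> r /qP qr [].
exfalso; apply: Fuv; apply: (carried_flat _ _ _ Fc) => //.
by move=> r /andP[ur rv] [_ hr]; apply: noq; exists r; split => //; rewrite ltW.
Qed.

(** * The regulators of a solution of the Skorokhod problem *)

(** The position h of f relative to the reflected path x + f1 - f2. *)
Definition gap (R : realType) (f f1 f2 : R -> R) (x s : R) : R :=
  f s - (x + f1 s - f2 s).

(** The two sides of the tube, indexed by a boolean so that upward and downward
    arguments are the same: true is the upper side. *)
Definition level (R : realType) (c : R) (sigma : bool) : R :=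
  if sigma then c / 2 else - (c / 2).

(** The regulator that acts on the side sigma: f1 above, f2 below. *)
Definition regulator (R : realType) (f1 f2 : R -> R) (sigma : bool) : R -> R :=
  if sigma then f1 else f2.

Section skorokhod.
Context (R : realType) (a b c x : R) (f f1 f2 : R -> R).
Hypothesis c0 : 0 < c.
Hypothesis fc : {within `[a, b], continuous f}.
Hypothesis sk : skorokhod_solution f a b c x f1 f2.
Let h := gap f f1 f2 x.
Let F := regulator f1 f2.

Lemma gap_continuous : {within `[a, b], continuous h}.
Proof.
move=> s; apply: cvgB; first exact: fc.
apply: cvgB; last exact: (sk_continuous2 sk).
by apply: cvgD; [exact: cvg_cst|exact: (sk_continuous1 sk)].
Qed.

Lemma regulator_init sigma : F sigma a = 0.
Proof. by case: sigma; [exact: (sk_init1 sk)|exact: (sk_init2 sk)]. Qed.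

Lemma regulator_nondecreasing sigma s t :
  a <= s -> s <= t -> t <= b -> F sigma s <= F sigma t.
Proof.
by case: sigma; [exact: (sk_nondecreasing1 sk)|exact: (sk_nondecreasing2 sk)].
Qed.

Lemma regulator_carried sigma :
  stieltjes_carried_by a b (F sigma) [set s | a <= s <= b /\ h s = level c sigma].
Proof. by case: sigma; [exact: (sk_carried1 sk)|exact: (sk_carried2 sk)]. Qed.

Lemma regulator_increase sigma u v :
  a <= u -> u <= v -> v <= b -> F sigma u <> F sigma v ->
  exists q, [/\ u <= q <= v, h q = level c sigma & F sigma q = F sigma v].
Proof. exact: last_increase gap_continuous (regulator_carried sigma). Qed.

(** Near every time h avoids one of the two sides, whose regulator is then
    constant. *)
Lemma regulator_locally_flat t : a <= t <= b ->
  exists2 d, 0 < d & exists sigma, forall u v,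
    a <= u -> t - d < u -> u <= v -> v < t + d -> v <= b ->
    F sigma u = F sigma v.
Proof.
move=> tab; have [sigma hsigma] : exists sigma, h t <> level c sigma.
  have [ht|ht] := eqVneq (h t) (c / 2); last by exists true; apply/eqP.
  by exists false; rewrite ht; apply/eqP; rewrite gt_eqF// /level; have := c0; lra.
have e0 : 0 < `|h t - level c sigma|.
  by rewrite normr_gt0 subr_eq0; apply/eqP.
have [d d0 dP] := within_itv_continuousP gap_continuous tab e0.
exists d => //; exists sigma => u v au tdu uv vtd vb; apply: contrapT.
move=> /(regulator_increase au uv vb) [q [quv hq _]].
have : `|h q - h t| < `|h t - level c sigma|.
  by apply: dP; [lra|rewrite ltr_norml; lra].
by rewrite hq distrC ltxx.
Qed.

(** As long as f stays in the tube around the starting point, nothing is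
    pushed. *)
Lemma regulator_eq0 T : T <= b ->
  (forall u, a <= u <= T -> - (c / 2) <= f u - x <= c / 2) ->
  forall t, a <= t <= T -> f1 t = 0 /\ f2 t = 0.
Proof.
move=> Tb fx t tT; suff H : forall sigma, F sigma t = 0.
  by split; [exact: (H true)|exact: (H false)].
move: t tT; apply: (@interval_induction R a T) => [|t taT].
  exact: regulator_init.
have [|d d0 [sigma flat]] := regulator_locally_flat (t := t); first by lra.
exists d => // u v au tu uv vt vT F0.
suff F1 : F (~~ sigma) v = 0.
  have F2 : F sigma v = 0 by rewrite -(flat u v)//; lra.
  by move=> tau; case: (eqVneq tau sigma) => [->//|];
     case: (tau) (sigma) F1 F2 => [] [].
rewrite -(F0 (~~ sigma)); apply: contrapT => /nesym neq.
have vb : v <= b by lra.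
(* at the last contact q, the constant regulator vanishes and the other does
   not, so that f q is out of the tube around x *)
have [q [quv hq Fq]] := regulator_increase au uv vb neq.
have Fq0 : F sigma q = 0 by rewrite -(flat u q) ?F0//; lra.
have Fq1 : 0 < F (~~ sigma) q.
  rewrite Fq lt_neqAle -(F0 (~~ sigma)); apply/andP; split; first exact/eqP.
  by apply: regulator_nondecreasing => //; lra.
have /fx : a <= q <= T by lra.
move: hq Fq0 Fq1; rewrite /h /gap /F /regulator /level.
by case: (sigma) => /=; lra.
Qed.

End skorokhod.
(** * Sums over a subdivision *)

Section phi_sum.
Context (R : realType).
Implicit Types (phi f F : R -> R) (s : seq R).

(** The sum of phi over the increments of f along the times of s, in the form
    used by phi_variation. *)
Definition phi_sum phi f s : R :=
  \sum_(0 <= i < (size s).-1) phi (f s`_i.+1 - f s`_i).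

Lemma phi_sum1 phi f p : phi_sum phi f [:: p] = 0.
Proof. by rewrite /phi_sum big_geq. Qed.

Lemma phi_sum_rcons2 phi f s p q :
  phi_sum phi f (rcons (rcons s p) q) =
  phi_sum phi f (rcons s p) + phi (f q - f p).
Proof.
rewrite /phi_sum !size_rcons/= big_nat_recr//=; congr (_ + phi (f _ - f _)).
- apply: eq_big_nat => i /andP[_ is_].
  by rewrite !(nth_rcons _ (rcons s p)) !size_rcons !ltnS is_ (ltnW is_).
- by rewrite nth_rcons size_rcons ltnn eqxx.
- by rewrite nth_rcons size_rcons ltnSn nth_rcons ltnn eqxx.
Qed.

Lemma sorted_rcons2 s p q :
  sorted <%R (rcons (rcons s p) q) = sorted <%R (rcons s p) && (p < q).
Proof. by case: s => [|y s] /=; rewrite ?andbT// rcons_path last_rcons. Qed.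

Lemma phi_sum_le phi f F a t s : a <= t ->
  (forall y, 0 <= phi y) ->
  (forall u v, a <= u -> u <= v -> v <= t -> phi (f v - f u) <= F v - F u) ->
  sorted <%R s -> {in s, forall u, a <= u <= t} ->
  phi_sum phi f s <= F t - F a.
Proof.
move=> at_ phi0 phiF.
have Fnd u v : a <= u -> u <= v -> v <= t -> F u <= F v.
  move=> au uv vt; rewrite -subr_ge0.
  exact: le_trans (phi0 _) (phiF _ _ au uv vt).
case/lastP: s => [_ _|s p ss st].
  by rewrite /phi_sum big_geq// subr_ge0 Fnd.
have pt : a <= p <= t by apply: st; rewrite mem_rcons mem_head.
apply: (@le_trans _ _ (F p - F a)); last by rewrite lerB// Fnd//; lra.
elim/last_ind: s p ss st pt => [p _ _ pt|s p IH q].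
  by rewrite phi_sum1 subr_ge0 Fnd//; lra.
rewrite sorted_rcons2 phi_sum_rcons2 => /andP[ss pq] st qt.
have pt : a <= p <= t by apply: st; rewrite mem_rcons inE mem_rcons mem_head orbT.
have := IH p ss _ pt; have := phiF p q.
have st' : {in rcons s p, forall u, a <= u <= t}.
  by move=> u us; apply: st; rewrite mem_rcons inE us orbT.
by move=> /(_ _ _ _)/[swap] /(_ st'); lra.
Qed.

End phi_sum.

(** * The first exit time *)

Lemma inf_segment (R : realType) (f : R -> R) (a s : R) :
  a <= s -> {within `[a, s], continuous f} ->
  exists p, [/\ a <= p <= s, inf [set f u | u in `[a, s]] = f p
    & forall u, a <= u <= s -> f p <= f u].
Proof.
move=> as_ fc; have [p] := EVT_min as_ fc; rewrite in_itv/= => pas pP.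
have pP' u : a <= u <= s -> f p <= f u by move=> ?; apply: pP; rewrite in_itv.
exists p; split => //; apply/eqP; rewrite eq_le; apply/andP; split.
  apply: ge_inf; first by exists (f p) => _ [u us <-]; exact: pP.
  by exists p => //=; rewrite in_itv.
apply: lb_le_inf; first by exists (f p); exists p => //=; rewrite in_itv.
by move=> _ [u us <-]; exact: pP.
Qed.

Lemma sup_segment_ge (R : realType) (f : R -> R) (a s u : R) :
  {within `[a, s], continuous f} -> a <= u <= s ->
  f u <= sup [set f u | u in `[a, s]].
Proof.
move=> fc us; have as_ : a <= s by lra.
have [p _ pP] := EVT_max as_ fc.
apply: ub_le_sup; first by exists (f p) => _ [v vs <-]; exact: pP.
by exists u => //=; rewrite in_itv.
Qed.

(** At T = tauU, if tauD is not smaller, f rises to its maximum on [a, T], which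
    exceeds its minimum on [a, T] by exactly c.  Before T all increments of f are
    smaller than c in absolute value, those upward because of tauU and those
    downward because of tauD.  Equality of tauU and tauD need not be excluded
    here. *)
Lemma tauU_spec (R : realType) (f : R -> R) (a b c : R) : 0 < c ->
  {within `[a, b], continuous f} ->
  (tauU f a b c <= tauD f a b c)%E -> (tauU f a b c < +oo)%E ->
  exists T, [/\ a <= T <= b, tauU f a b c = T%:E,
    forall u, a <= u <= T -> f T - c <= f u <= f T
    & exists2 p, a <= p <= T & f p = f T - c].
Proof.
move=> c0 fc; rewrite /tauU; set A := [set s | _].
have fcs s : s <= b -> {within `[a, s], continuous f}.
  move=> sb; apply: continuous_subspaceW fc => u /=; rewrite !in_itv/=; lra.
have [/eqP->|/set0P A0] := boolP (A == set0).
  by rewrite image_set0 ereal_inf0 ltxx.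
have lA : has_lbound A by exists a => s [/andP[]].
rewrite ereal_inf_EFin//; set T := inf A => TD _.
have aT : a <= T by apply: lb_le_inf => // s [/andP[]].
have Tb : T <= b.
  by have [s As] := A0; apply: (@le_trans _ _ s); [exact: ge_inf|case: As => /andP[]].
have up u s : a <= u -> u <= s -> s < T -> f s - f u < c.
  move=> au us sT; rewrite ltNge; apply/negP => cfu.
  suff /(ge_inf lA) : A s by rewrite -/T; lra.
  split; first lra.
  have sb : s <= b by lra.
  have [|p [_ -> /(_ u)]] := inf_segment (f := f) _ (fcs s sb); lra.
have down u s : a <= u -> u <= s -> s < T -> f u - f s < c.
  move=> au us sT; rewrite ltNge; apply/negP => cfu.
  suff : (tauD f a b c <= s%:E)%E.
    by move=> /(le_trans TD); rewrite lee_fin; lra.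
  apply: ereal_inf_lbound; exists s => //; split; first by lra.
  have sb : s <= b by lra.
  have := @sup_segment_ge R f a s u (fcs s sb); lra.
have [p [paT _ pP]] := inf_segment aT (fcs _ Tb).
(* the infimum defining tauU is attained *)
have fT : c <= f T - f p.
  rewrite leNgt; apply/negP => fTp.
  pose e := (c - (f T - f p)) / 2.
  have e0 : 0 < e by rewrite /e; lra.
  have [|d d0 dP] := within_itv_continuousP (x := T) fc _ e0; first by lra.
  have [s As sd] := inf_adherent d0 (conj A0 lA).
  have Ts : T <= s by exact: ge_inf.
  have [sab] := As.
  have [||q [qas -> _]] := @inf_segment R f a s; [lra|by apply: fcs; lra|].
  have /ltr_normlP[] : `|f s - f T| < e by apply: dP => //; rewrite ger0_norm; lra.
  have := pP T; have [qT|Tq] := leP q T.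
    by have := pP q; rewrite /e; lra.
  have /ltr_normlP[] : `|f q - f T| < e by apply: dP; [|rewrite ger0_norm]; lra.
  by rewrite /e; lra.
have pT : p < T.
  by rewrite lt_neqAle; case: eqVneq fT => [->|]; lra.
have fTp : f T - f p <= c.
  rewrite leNgt; apply/negP => cf.
  have e0 : 0 < f T - f p - c by lra.
  have [|d d0 dP] := within_itv_continuousP (x := T) fc _ e0; first by lra.
  have : p <= Num.max p (T - d / 2) by rewrite le_max lexx.
  have : T - d / 2 <= Num.max p (T - d / 2) by rewrite le_max lexx orbT.
  have : Num.max p (T - d / 2) < T by rewrite gt_max pT/=; lra.
  (* the increments before T are less than c; pass to the limit at T *)
  set s := Num.max _ _ => sT ds ps.
  have /ltr_normlP[] : `|f s - f T| < f T - f p - c.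
    by apply: dP; [lra|rewrite ltr0_norm; lra].
  by have := up p s; lra.
have fpT : f p = f T - c by lra.
exists T; split => //; first by rewrite aT.
  move=> u uaT; have := pP u; have [->|uT] := eqVneq u T; first by lra.
  have {}uT : u < T by rewrite lt_neqAle uT; lra.
  have [up_|pu] := leP u p; first by have := down u p; lra.
  by have := up p u; lra.
by exists p.
Qed.

Lemma tauU_opp (R : realType) (f : R -> R) (a b c : R) :
  tauU (- f) a b c = tauD f a b c.
Proof.
rewrite /tauU /tauD; congr (ereal_inf (_ @` _)); apply/seteqP.
have E s : inf [set (- f) u | u in `[a, s]] = - sup [set f u | u in `[a, s]].
  rewrite /inf; congr (- sup _); apply/seteqP.
  split => [_ [_ [u us <-] <-]|_ [u us <-]].
    by exists u => //; rewrite /= opprK.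
  by exists (- f u); [exists u|rewrite opprK].
by split=> s /= [sab]; rewrite E opprK addrC.
Qed.

Lemma tauD_opp (R : realType) (f : R -> R) (a b c : R) :
  tauD (- f) a b c = tauU f a b c.
Proof. by rewrite -tauU_opp opprK. Qed.

(** The starting point is the centre of a tube which contains f until
    min (tauU, tauD) and whose two sides are touched by then, the last one at
    that time. *)
Lemma first_exit (R : realType) (a b c : R) (f : R -> R) :
  0 < c -> {within `[a, b], continuous f} ->
  (Order.min (tauU f a b c) (tauD f a b c) < +oo)%E ->
  let x := start_point f a b c in
  exists sigma p q, [/\ a <= p, p <= q, q <= b,
    Order.min (tauU f a b c) (tauD f a b c) = q%:E &
    [/\ forall u, a <= u <= q -> - (c / 2) <= f u - x <= c / 2,
        f p - x = level c (~~ sigma) & f q - x = level c sigma]].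
Proof.
move=> c0 fc + x; rewrite {}/x /start_point.
case: (ltP (tauU f a b c) (tauD f a b c)) => UD fin.
  have [T [aTb TE fT [p pT fp]]] := tauU_spec c0 fc (ltW UD) fin.
  exists true, p, T; rewrite TE /= /level; split; [lra..|by []|].
  by split; [move=> u /fT|..]; lra.
have Nfc : {within `[a, b], continuous (- f)} by move=> s; apply: cvgN; exact: fc.
have := @tauU_spec R (- f) a b c c0 Nfc; rewrite tauU_opp tauD_opp.
move=> /(_ UD fin) [T [aTb TE fT [p pT fp]]].
exists false, p, T; rewrite TE /= /level.
have fE u : (- f) u = - f u by [].
rewrite !fE in fp; split; [lra..|by []|].
by split; [move=> u /fT; rewrite !fE|..]; lra.
Qed.

(** * Alternation between the two sides of the tube *)

Section alternation.
Context (R : realType) (a b c x : R) (f f1 f2 : R -> R).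
Hypothesis c0 : 0 < c.
Hypothesis fc : {within `[a, b], continuous f}.
Hypothesis sk : skorokhod_solution f a b c x f1 f2.
Let h := gap f f1 f2 x.
Let F := regulator f1 f2.
Let phi (y : R) := Num.max (`|y| - c) 0.

Lemma regulator_between sigma u q v : a <= u -> u <= q -> q <= v -> v <= b ->
  F sigma u = F sigma v -> F sigma u = F sigma q /\ F sigma q = F sigma v.
Proof.
move=> au uq qv vb Fuv.
have H1 : F sigma u <= F sigma q by apply: (regulator_nondecreasing sk) => //; lra.
have H2 : F sigma q <= F sigma v by apply: (regulator_nondecreasing sk) => //; lra.
by split; lra.
Qed.

(** Extending a subdivision from a contact with one side to a contact with the
    other, while the regulator of the first side is flat. *)
Lemma phi_sum_contact sigma s p q : a <= p -> p <= q -> q <= b ->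
  h p = level c (~~ sigma) -> h q = level c sigma ->
  F (~~ sigma) p = F (~~ sigma) q ->
  phi_sum phi f (rcons s p) = f1 p + f2 p ->
  p < q /\ phi_sum phi f (rcons (rcons s p) q) = f1 q + f2 q.
Proof.
have cpos := c0.
move=> ap pq qb hp hq Fpq sp; split.
  rewrite lt_neqAle pq andbT; apply/eqP => pqE; move: hp; rewrite pqE hq /level.
  case: sigma {hq Fpq} => /= cc; have : c = 0 by lra.
    by move=> cE; move: cpos; rewrite cE ltxx.
  by move=> cE; move: cpos; rewrite cE ltxx.
rewrite phi_sum_rcons2 sp.
have Fs : F sigma p <= F sigma q by exact: (regulator_nondecreasing sk).
suff -> : phi (f q - f p) = F sigma q - F sigma p.
  by move: Fpq; rewrite /F /regulator; case: (sigma) => /=; lra.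
have fqp : f q - f p = if sigma then c + (f1 q - f1 p) else - (c + (f2 q - f2 p)).
  by move: hp hq Fpq; rewrite /h /gap /F /regulator /level; case: (sigma) => /=; lra.
rewrite /phi; have -> : `|f q - f p| = c + (F sigma q - F sigma p).
  rewrite fqp; move: Fs; rewrite /F /regulator; case: (sigma) => /= Fs.
    by rewrite ger0_norm//; lra.
  by rewrite normrN ger0_norm//; lra.
by rewrite addrC addKr max_l// subr_ge0.
Qed.

(** The state of the alternation at time t: q is a contact with the side sigma
    that accounts for all its pushes until t, p is an earlier contact with the
    other side after which that side has not pushed, and the subdivision that
    ends at p is exact.  The time q is not yet in the subdivision because it may
    be replaced by a later contact with the same side. *)
Definition phase t : Prop := exists sigma s p q,
  [/\ sorted <%R (rcons s p), {in rcons s p, forall u, a <= u <= p},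
      p <= q <= t, h p = level c (~~ sigma) /\ h q = level c sigma &
      [/\ phi_sum phi f (rcons s p) = f1 p + f2 p,
          F (~~ sigma) p = F (~~ sigma) t & F sigma q = F sigma t]].

Lemma phase_extend t : a <= t <= b -> phase t ->
  exists s, [/\ sorted <%R s, {in s, forall u, a <= u <= t} &
    phi_sum phi f s = f1 t + f2 t].
Proof.
move=> tab [sigma [s [p [q [ss sin /andP[pq qt] [hp hq] [sp Fp Fq]]]]]].
have /andP[ap _] : a <= p <= p by apply: sin; rewrite mem_rcons mem_head.
have tb : t <= b by lra.
have qb : q <= b by lra.
have [Fpq Fqt] := regulator_between ap pq qt tb Fp.
have [pltq sq] := phi_sum_contact ap pq qb hp hq Fpq sp.
exists (rcons (rcons s p) q); split.
- by rewrite sorted_rcons2 ss.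
- by move=> u; rewrite mem_rcons inE => /orP[/eqP->|/sin]; lra.
- rewrite sq; move: Fqt Fq; rewrite /F /regulator.
  by case: (sigma) => /= -> ->.
Qed.

Lemma phase_propagate sigma u v : a <= u -> u <= v -> v <= b ->
  F sigma u = F sigma v -> phase u -> phase v.
Proof.
move=> au uv vb flat [tau [s [p [q [ss sin /andP[pq qu] [hp hq] [sp Fp Fq]]]]]].
have /andP[ap _] : a <= p <= p by apply: sin; rewrite mem_rcons mem_head.
have [F'|F'] := eqVneq (F (~~ sigma) u) (F (~~ sigma) v).
  have Fuv rho : F rho u = F rho v.
    by case: (eqVneq rho sigma) => [->//|]; case: (rho) (sigma) flat F' => [] [].
  exists tau, s, p, q; split => //; last by rewrite -!Fuv.
  by rewrite pq (le_trans qu).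
(* the side ~~ sigma pushes on [u, v], and q' accounts for all of its push *)
have [q' [/andP[uq' q'v] hq' Fq']] :=
  regulator_increase fc sk au uv vb (elimN eqP F').
have [E|E] := eqVneq tau sigma.
  (* q becomes the last time of the subdivision, and the sides are exchanged *)
  rewrite {}E {tau} in hp hq Fp Fq *.
  have ub : u <= b by lra.
  have [Fpq Fqu] := regulator_between ap pq qu ub Fp.
  have qb : q <= b by lra.
  have [pltq sq] := phi_sum_contact ap pq qb hp hq Fpq sp.
  exists (~~ sigma), (rcons s p), q, q'; split.
  - by rewrite sorted_rcons2 ss.
  - by move=> w; rewrite mem_rcons inE => /orP[/eqP->|/sin]; lra.
  - by lra.
  - by rewrite negbK.
  - by rewrite negbK Fq flat.
have {}E : tau = ~~ sigma by case: (tau) (sigma) E => [] [].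
(* same side as before: the later contact q' replaces q *)
rewrite {}E {tau} negbK in hp hq Fp Fq *.
exists (~~ sigma), s, p, q'; rewrite negbK; split => //; first by lra.
by rewrite Fp flat.
Qed.

Lemma phase_all r : a <= r -> phase r ->
  forall t, r <= t <= b -> phase t.
Proof.
move=> ar; move/interval_induction; apply => t tb.
have [|d d0 [sigma flat]] := regulator_locally_flat c0 fc sk (t := t).
  by lra.
exists d => // u v ru tdu uv vtd vb.
apply: (phase_propagate (sigma := sigma)) => //; first by lra.
by apply: flat => //; lra.
Qed.

(** If f stays in the tube around x on [a, q], with contacts on opposite sides at
    p and q, then f1 t + f2 t is the full truncated sum of a subdivision. *)
Lemma tv_attained sigma p q : a <= p -> p <= q -> q <= b ->
  (forall u, a <= u <= q -> - (c / 2) <= f u - x <= c / 2) ->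
  f p - x = level c (~~ sigma) -> f q - x = level c sigma ->
  forall t, a <= t <= b -> exists s, [/\ sorted <%R s,
    {in s, forall u, a <= u <= t} & phi_sum phi f s = f1 t + f2 t].
Proof.
move=> ap pq qb tube fp fq t tab.
have F0 := regulator_eq0 c0 fc sk qb tube.
have [p1 p2] : f1 p = 0 /\ f2 p = 0 by apply: F0; lra.
have [q1 q2] : f1 q = 0 /\ f2 q = 0 by apply: F0; lra.
have [tq|/ltW qt] := leP t q.
  have [|-> ->] := F0 t; first by lra.
  by exists [::]; split => //; rewrite /phi_sum big_geq// addr0.
apply: phase_extend => //; apply: (@phase_all q); [lra| |lra].
exists sigma, [::], p, q; split => //.
- by move=> u; rewrite inE => /eqP->; lra.
- by lra.
- by rewrite /h /gap p1 p2 q1 q2 !addr0 !subr0.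
- rewrite phi_sum1 p1 p2 addr0; split => //.
  by rewrite /F /regulator; case: (sigma) => /=; lra.
Qed.

End alternation.

(** * The truncated variations *)

Lemma phi_variation_attained (R : realType) (phi f : R -> R) (a t : R) s :
  sorted <%R s -> {in s, forall u, a <= u <= t} ->
  (forall s', sorted <%R s' -> {in s', forall u, a <= u <= t} ->
    phi_sum phi f s' <= phi_sum phi f s) ->
  phi_variation phi f a t = (phi_sum phi f s)%:E.
Proof.
move=> ss sin smax; apply/eqP; rewrite eq_le; apply/andP; split.
  by apply: ge_ereal_sup => _ [s' [ss' sin'] <-]; rewrite lee_fin; exact: smax.
by apply: ereal_sup_ubound; exists s.
Qed.

(** A subdivision attaining f1 t + f2 t for the full truncated sum determines
    the three truncated variations. *)
Lemma truncated_variations (R : realType) (a b c x : R) (f f1 f2 : R -> R) t s :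
  0 < c -> skorokhod_solution f a b c x f1 f2 -> a <= t <= b ->
  sorted <%R s -> {in s, forall u, a <= u <= t} ->
  phi_sum (fun y => Num.max (`|y| - c) 0) f s = f1 t + f2 t ->
  [/\ UTV c f a t = (f1 t)%:E, DTV c f a t = (f2 t)%:E &
      TV c f a t = (f1 t + f2 t)%:E].
Proof.
move=> c0 sk tab ss sin sE.
have max0 (y : R) : 0 <= Num.max y 0 by rewrite le_max lexx orbT.
pose phi (y : R) := Num.max (`|y| - c) 0.
pose phiU (y : R) := Num.max (y - c) 0.
pose phiD (y : R) := Num.max (- y - c) 0.
have phiE y : phi y = phiU y + phiD y.
  rewrite /phi /phiU /phiD; have [y0|y0] := leP 0 y.
    by rewrite ger0_norm// [Num.max (- y - c) 0]max_r; [rewrite addr0|lra].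
  by rewrite ltr0_norm// [Num.max (y - c) 0]max_r; [rewrite add0r|lra].
have incr u v : a <= u -> u <= v -> v <= t ->
    [/\ phiU (f v - f u) <= f1 v - f1 u & phiD (f v - f u) <= f2 v - f2 u].
  move=> au uv vt.
  have vb : v <= b by lra.
  have := sk_nondecreasing1 sk au uv vb; have := sk_nondecreasing2 sk au uv vb.
  have : a <= u <= b by lra.
  have : a <= v <= b by lra.
  move=> /(sk_tube sk) + /(sk_tube sk).
  by rewrite /phiU /phiD !ge_max => *; split; apply/andP; split; lra.
have at_ : a <= t by lra.
have leU s' : sorted <%R s' -> {in s', forall u, a <= u <= t} ->
    phi_sum phiU f s' <= f1 t.
  move=> ss' sin'; rewrite -[f1 t]subr0 -(sk_init1 sk).
  apply: (phi_sum_le at_) => [y|u v au uv vt|//|//]; first exact: max0.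
  by have [] := incr u v au uv vt.
have leD s' : sorted <%R s' -> {in s', forall u, a <= u <= t} ->
    phi_sum phiD f s' <= f2 t.
  move=> ss' sin'; rewrite -[f2 t]subr0 -(sk_init2 sk).
  apply: (phi_sum_le at_) => [y|u v au uv vt|//|//]; first exact: max0.
  by have [] := incr u v au uv vt.
have split_sum s' : phi_sum phi f s' = phi_sum phiU f s' + phi_sum phiD f s'.
  by rewrite /phi_sum -big_split; apply: eq_bigr => i _ /=; rewrite phiE.
have sumE := split_sum s; rewrite sE in sumE.
have UE : phi_sum phiU f s = f1 t.
  by have := leU s ss sin; have := leD s ss sin; lra.
have DE : phi_sum phiD f s = f2 t by lra.
split.
- by rewrite -UE; apply: phi_variation_attained => // s' *; rewrite UE leU.
- by rewrite -DE; apply: phi_variation_attained => // s' *; rewrite DE leD.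
- rewrite -sE; apply: phi_variation_attained => // s' *.
  by rewrite sE split_sum lerD// ?leU ?leD.
Qed.

Theorem proposition2 (R : realType) (a b c : R) (f f1 f2 : R -> R) :
  a < b ->
  {within `[a, b], continuous f} ->
  0 < c ->
  (Order.min (tauU f a b c) (tauD f a b c) < +oo)%E ->
  skorokhod_solution f a b c (start_point f a b c) f1 f2 ->
  [/\ forall t, a <= t <= b ->
        gc f a c (start_point f a b c) t
          = (start_point f a b c + f1 t - f2 t)%:E,
      forall t, a <= t <= b -> TV c f a t = (f1 t + f2 t)%:E
    & forall s, a <= s <= b ->
        (s%:E <= Order.min (tauU f a b c) (tauD f a b c))%E ->
        f1 s = 0 /\ f2 s = 0].
Proof.
move=> ab fc c0 /(first_exit c0 fc); set x := start_point _ _ _ _.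
move=> [sigma [p [q [ap pq qb -> [tube fp fq]]]]] sk.
have main t : a <= t <= b -> [/\ UTV c f a t = (f1 t)%:E,
    DTV c f a t = (f2 t)%:E & TV c f a t = (f1 t + f2 t)%:E].
  move=> tab.
  have [s [ss sin sE]] := tv_attained c0 fc sk ap pq qb tube fp fq tab.
  exact: truncated_variations c0 sk tab ss sin sE.
split=> [t /main[U D _]|t /main[]//|s sab].
  by rewrite /gc U D EFinB EFinD.
by rewrite lee_fin => sq; apply: (regulator_eq0 c0 fc sk qb tube); lra.
Qed.
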